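(* Let $\mathbb{K}$ be a field, let $\mathbf{m}=(m_1,\dots,m_n)$ be a nonzero sequence of nonnegative integers with $m_n=0$, and define $p=\max\{j\in\{1,\dots,n\}:m_j\neq0\}$. The intersection complex $\Delta=\mathfrak{I}(\mathbf{m})$ is PR (over $\mathbb{K}$) with degree type $(d_p,\dots,d_1)$, where for each $1\le i\le p$, $$d_i=\sum_{j=0}^{n-i-1}\binom{n-i-1}{j}m_{i+j}.$$
   Context: Intersection complexes: for a sequence $\mathbf{m}=(m_1,\dots,m_n)$ of nonnegative integers, $\mathfrak{I}(\mathbf{m})$ is the simplicial complex whose vertices are all symbols $v_S^r$ where $S$ is a nonempty subset of $[n]=\{1,\dots,n\}$ and $1\le r\le m_{|S|}$, and whose faces are all subsets of the sets $F_1,\dots,F_n$, where $F_j=\{v_S^r: S\subseteq[n],\ j\in S,\ 1\le r\le m_{|S|}\}$. PR complexes: $\widetilde{H}_i$ is reduced simplicial homology with coefficients in $\mathbb{K}$ (with $\widetilde H_{-1}(\{\emptyset\})=\mathbb{K}$), and $\mathrm{link}_\Delta\sigma=\{\tau\in\Delta:\sigma\cap\tau=\emptyset,\sigma\cup\tau\in\Delta\}$ for a face $\sigma$. A simplicial complex $\Delta$ is PR (over $\mathbb{K}$) if for every $i\ge-1$ and all faces $\sigma,\tau\in\Delta$ with $\widetilde H_i(\mathrm{link}_\Delta\sigma)\ne0\ne\widetilde H_i(\mathrm{link}_\Delta\tau)$ we have $|\sigma|=|\tau|$. For a PR complex $\Delta$, let $q$ be the maximum index for which some face $\sigma$ has $\widetilde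 H_{q-1}(\mathrm{link}_\Delta\sigma)\neq0$. For each $0\le i\le q$ faces $\sigma$ with $\widetilde H_{i-1}(\mathrm{link}_\Delta\sigma)\ne0$ exist; let $s_i$ be their common size. The degree type of $\Delta$ is $(d_q,\dots,d_1)$ with $d_i=s_{i-1}-s_i$ (these are positive integers). *)

(* Defs.v *)
From HB Require Import structures.
From mathcomp Require Import all_boot all_order all_algebra.

Set Implicit Arguments.
Unset Strict Implicit.
Unset Printing Implicit Defensive.

Import GRing.Theory.
Local Open Scope ring_scope.

(* The elements of T form the ambient vertex set; they need not all be
   vertices of the complex, so that a link lives over the same T. *)
Record complex (T : finType) := Complex {
  faces :> {set {set T}};
  faces_closed : forall s t : {set T}, s \in faces -> t \subset s -> t \in faces
}.

Section Link.
Variables (T : finType) (D : complex T) (s : {set T}).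

Definition link_faces : {set {set T}} :=
  [set t in faces D | (s :&: t == set0) && (s :|: t \in faces D)].

Lemma link_closed (t u : {set T}) :
  t \in link_faces -> u \subset t -> u \in link_faces.
Proof.
rewrite !inE => /and3P[tD st0 stD] ut; apply/and3P; split.
- exact: faces_closed tD ut.
- by rewrite -subset0 -(eqP st0) setIS.
- by apply: faces_closed stD _; rewrite setUS.
Qed.

Definition link : complex T := Complex link_closed.

End Link.

Section ReducedHomology.
Variables (K : fieldType) (T : finType).

(* One space of chains serves all complexes over T and all degrees; vertices
   are ordered by enum_rank to fix orientations. *)
Definition chain_space := {ffun {set T} -> K^o}.

Definition basis_chain (s : {set T}) : chain_space :=
  [ffun t => (t == s)%:R].

Definition position (s : {set T}) (x : T) : nat :=
  #|[set y in s | (enum_rank y < enum_rank x)%N]|.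

Definition boundary_fun (f : chain_space) : chain_space :=
  \sum_(s : {set T})
     f s *: \sum_(x in s) (-1) ^+ position s x *: basis_chain (s :\ x).

Lemma boundary_fun_linear : linear boundary_fun.
Proof.
move=> a f g; rewrite /boundary_fun scaler_sumr -big_split /=.
by apply: eq_bigr => s _; rewrite !ffunE scalerDl scalerA.
Qed.

HB.instance Definition _ :=
  GRing.isLinear.Build K chain_space chain_space _ boundary_fun
    boundary_fun_linear.

Definition boundary : 'End(chain_space) := linfun boundary_fun.

(* In the next four definitions k counts vertices, so k stands for
   homological degree k - 1, and k = 0 for degree -1 (the empty face). *)
Definition chains (D : complex T) (k : nat) : {vspace chain_space} :=
  <<[seq basis_chain s | s in [set s in faces D | #|s| == k]]>>%VS.

Definition cycles (D : complex T) (k : nat) : {vspace chain_space} :=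
  (chains D k :&: lker boundary)%VS.

Definition boundaries (D : complex T) (k : nat) : {vspace chain_space} :=
  (boundary @: chains D k.+1)%VS.

(* The reduced homology of D in degree k - 1. MathComp has no quotients of
   vector spaces: the quotient cycles / boundaries is realized as the
   complement of the boundaries in the cycles provided by the library. *)
Definition homology (D : complex T) (k : nat) : {vspace chain_space} :=
  (cycles D k :\: boundaries D k)%VS.

Definition is_PR (D : complex T) : Prop :=
  forall (k : nat) (s t : {set T}), s \in faces D -> t \in faces D ->
    homology (link D s) k != 0%VS -> homology (link D t) k != 0%VS ->
    #|s| = #|t|.

(* d = (d_q, ..., d_1); differences are taken in int to avoid truncation. *)
Definition has_degree_type (D : complex T) (d : seq nat) : Prop :=
  exists (q : nat) (size_of : nat -> nat),
    [/\ exists2 s, s \in faces D & homology (link D s) q != 0%VS,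
        forall k s, s \in faces D -> homology (link D s) k != 0%VS ->
          (k <= q)%N,
        forall i, (i <= q)%N ->
          (exists2 s, s \in faces D & homology (link D s) i != 0%VS) /\
          (forall s, s \in faces D -> homology (link D s) i != 0%VS ->
             #|s| = size_of i)
      & [seq Posz e | e <- d] =
        [seq (size_of i.-1)%:Z - (size_of i)%:Z | i <- rev (iota 1 q)]].

End ReducedHomology.

(* m_j with indices starting at 1; it is 0 for j = 0 and for j > n. *)
Definition entry (n : nat) (m : n.-tuple nat) (j : nat) : nat :=
  nth 0%N (0%N :: m) j.

Section IntersectionComplex.
Variables (n : nat) (m : n.-tuple nat).

(* [n] is 'I_n, and the superscript r is shifted to start at 0. *)
Definition nonempty_subset := {S : {set 'I_n} | S != set0}.

Definition ivertex := {S : nonempty_subset & 'I_(entry m #|val S|)}.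

Definition support_of (v : ivertex) : {set 'I_n} := val (tag v).

Definition facet (j : 'I_n) : {set ivertex} :=
  [set v : ivertex | j \in support_of v].

Definition intersection_faces : {set {set ivertex}} :=
  [set s : {set ivertex} | [exists j, s \subset facet j]].

Lemma intersection_closed (s t : {set ivertex}) :
  s \in intersection_faces -> t \subset s -> t \in intersection_faces.
Proof.
rewrite !inE => /existsP[j sj] ts; apply/existsP; exists j.
exact: subset_trans ts sj.
Qed.

Definition intersection_complex : complex ivertex :=
  Complex intersection_closed.

End IntersectionComplex.

(* Main.v *)
Require Import Defs.
From mathcomp Require Import all_boot all_order all_algebra.
From mathcomp Require Import zify ring.

Set Implicit Arguments.
Unset Strict Implicit.
Unset Printing Implicit Defensive.

Import GRing.Theory.

(* The link of a face s is the union of the simplices F_j \ s over the set A of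
   those j with s contained in F_j. If some vertex v_S^r outside s has S
   containing A, then all these simplices share a vertex and the link is
   acyclic. Otherwise s = {v_S^r : A is contained in S}, and a subfamily indexed
   by J has a common vertex exactly when |J| <= min (|A| - 1, p): the nerve is a
   full skeleton of the simplex on A. A Mayer-Vietoris induction on
   the number of simplices shows that the reduced homology of the link is then
   nonzero exactly in degree k - 1, where k = min (|A| - 1, p). If s is nonempty,
   |A| = k + 1 <= p; if s is empty, A = [n] and k = p. Counting supersets of A
   gives |s|, and Pascal's rule gives the differences. *)

(** * Reduced chains, cones and Mayer-Vietoris exactness *)

Section Chains.
Local Open Scope ring_scope.
Variables (K : fieldType) (T : finType).
Implicit Types (f g z : chain_space K T) (s t : {set T}) (v x : T).

Lemma position_setU1 t x v : x \notin t ->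
  position (x |: t) v = ((enum_rank x < enum_rank v) + position t v)%N.
Proof.
move=> xt; rewrite /position.
have -> : [set y in x |: t | (enum_rank y < enum_rank v)%N] =
    if (enum_rank x < enum_rank v)%N
    then x |: [set y in t | (enum_rank y < enum_rank v)%N]
    else [set y in t | (enum_rank y < enum_rank v)%N].
  by apply/setP=> y; case: ifP => xv; rewrite !inE; have [->|] := eqVneq y x;
    rewrite /= ?xv ?andbF.
by case: ifP => xv; rewrite ?cardsU1 // !inE (negPf xt).
Qed.

Lemma boundaryE f t :
  boundary K T f t = \sum_(x | x \notin t) (-1) ^+ position t x * f (x |: t).
Proof.
rewrite lfunE /= /boundary_fun sum_ffunE.
transitivity (\sum_(s : {set T}) \sum_(x in s)
   f s * ((-1) ^+ position s x * (t == s :\ x)%:R)).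
  apply: eq_bigr => s _; rewrite ffunE sum_ffunE scaler_sumr.
  by apply: eq_bigr => x _; rewrite !ffunE.
rewrite (exchange_big_dep predT) //= [RHS]big_mkcond /=.
apply: eq_bigr => x _; case: ifPn => xt.
  rewrite (bigD1 (x |: t)) ?setU11 //= setU1K // eqxx mulr1 big1 ?addr0.
    by rewrite position_setU1 // ltnn mulrC.
  move=> s /andP[xs sn]; case: eqP => [e|]; last by rewrite !mulr0.
  by rewrite e setD1K ?eqxx in sn.
apply: big1 => s xs; case: eqP => [e|]; last by rewrite !mulr0.
by rewrite e !inE eqxx in xt.
Qed.

(* Left multiplication by v in the exterior algebra on the vertices; the
   boundary is contraction with the sum of the coordinate functions. *)
Definition cone v f : chain_space K T :=
  [ffun t : {set T} => if v \in t then (-1) ^+ position t v * f (t :\ v) else 0].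

(** Contraction is an antiderivation, so coning with [v] is a homotopy from the identity to zero. At
    sets without [v] only the term adding [v] survives; at sets containing [v] one term gives [f t]
    and the others cancel in pairs, since [v] and [x] anticommute. *)
Lemma boundary_cone v f :
  boundary K T (cone v f) + cone v (boundary K T f) = f.
Proof.
apply/ffunP => t; rewrite !ffunE boundaryE.
have sq (n : nat) : (-1) ^+ n * (-1) ^+ n = 1 :> K by rewrite -expr2 sqrr_sign.
case: ifPn => vt; last first.
  rewrite addr0 (bigD1 v) //= ffunE setU11 setU1K // big1 ?addr0.
    by rewrite position_setU1 // ltnn mulrA sq mul1r.
  move=> x /andP[_ xv].
  by rewrite ffunE !inE eq_sym (negPf xv) (negPf vt) mulr0.
rewrite boundaryE [X in _ * X](bigD1 v) /=; last by rewrite !inE eqxx.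
have pos_t x : position t x =
    ((enum_rank v < enum_rank x) + position (t :\ v) x)%N.
  by rewrite -{1}(setD1K vt) position_setU1 // !inE eqxx.
rewrite setD1K // mulrDr mulrA pos_t ltnn sq mul1r addrCA mulr_sumr.
rewrite [X in _ + (_ + X)](eq_bigl (fun x => x \notin t)); last first.
  move=> x; rewrite !inE negb_and negbK; case: eqVneq => [->|] /=.
    by rewrite vt.
  by rewrite andbT.
rewrite -big_split /= big1 ?addr0 // => x xt.
have xv : x != v by apply: contraNneq xt => ->.
have vx : v != x by rewrite eq_sym.
rewrite ffunE !inE vt orbT.
have -> : (x |: t) :\ v = x |: (t :\ v).
  by apply/setP => y; rewrite !inE; case: eqVneq => [->|];
    rewrite ?orbF //= eq_sym (negPf xv).
rewrite position_setU1 // !pos_t ltnn.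
have : enum_rank v != enum_rank x by rewrite (inj_eq enum_rank_inj).
rewrite -(inj_eq val_inj) /= => ne; rewrite !exprD.
by case: ltngtP ne => //= _ _; rewrite ?expr1 ?expr0; ring.
Qed.

Lemma basis_chain_cone s v : v \in s ->
  basis_chain K s = (-1) ^+ position s v *: cone v (basis_chain K (s :\ v)).
Proof.
move=> vs; apply/ffunP => t; rewrite !ffunE.
have [->|ts] := eqVneq t s.
  by rewrite vs eqxx mulr1 /GRing.scale /= -expr2 sqrr_sign.
case: ifP => vt; last by rewrite scaler0.
case: eqP => [e|]; last by rewrite mulr0 scaler0.
by rewrite -(setD1K vt) e setD1K ?eqxx in ts.
Qed.

Lemma chainE f : f = \sum_s f s *: basis_chain K s.
Proof.
apply/ffunP => t; rewrite sum_ffunE (bigD1 t) //= !ffunE eqxx.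
rewrite [X in _ = X + _]mulr1 big1 ?addr0 // => s st.
by rewrite !ffunE eq_sym (negPf st) [LHS]mulr0.
Qed.

Lemma cone0 v : cone v 0 = 0.
Proof. by apply/ffunP => t; rewrite !ffunE mulr0 if_same. Qed.

(** Induction on the size of a face: [boundary_cone], applied twice, moves the double boundary
    inside the cone, onto a smaller face. *)
Lemma boundary_boundary f : boundary K T (boundary K T f) = 0.
Proof.
rewrite (chainE f) !linear_sum big1 // => s _; rewrite !linearZ /=.
rewrite [X in _ *: X](_ : _ = 0) ?scaler0 //.
have [n] := ubnP #|s|; elim: n s => // n IHn s; rewrite ltnS => sn.
have [->|[v vs]] := set_0Vmem s.
  rewrite (_ : boundary K T (basis_chain K set0) = 0) ?linear0 //.
  apply/ffunP => t; rewrite boundaryE ffunE big1 // => x xt.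
  rewrite ffunE (_ : (_ == _) = false) ?mulr0 //.
  by apply/negP => /eqP/setP/(_ x); rewrite !inE eqxx.
rewrite (basis_chain_cone vs) !linearZ /=.
set b := basis_chain K (s :\ v).
have d_cone g : boundary K T (cone v g) = g - cone v (boundary K T g).
  by rewrite -{2}(boundary_cone v g) addrK.
rewrite d_cone linearB /= d_cone IHn ?cone0 ?subr0 ?subrr ?scaler0 //.
by rewrite (cardsD1 v s) vs in sn; lia.
Qed.

(** A pointwise form of membership in [chains] (see [chainsP]), for bare families of sets so that
    unions and intersections are at hand; [k] again counts vertices. *)
Definition supported (D : {set {set T}}) (k : nat) f : Prop :=
  forall s, f s != 0 -> s \in D /\ #|s| = k.

Lemma supportedD D k f g :
  supported D k f -> supported D k g -> supported D k (f + g).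
Proof.
move=> fD gD s; rewrite ffunE; have [fs|/fD//] := eqVneq (f s) 0.
by rewrite fs add0r => /gD.
Qed.

Lemma supportedN D k f : supported D k f -> supported D k (- f).
Proof. by move=> fD s; rewrite ffunE oppr_eq0; apply: fD. Qed.

Lemma supportedB D k f g :
  supported D k f -> supported D k g -> supported D k (f - g).
Proof. by move=> fD gD; apply: supportedD => //; apply: supportedN. Qed.

Lemma supported_sub (D E : {set {set T}}) k f :
  D \subset E -> supported D k f -> supported E k f.
Proof. by move=> /subsetP DE fD s /fD[/DE sE sk]. Qed.

Lemma supportedI (D E : {set {set T}}) k f :
  supported D k f -> supported E k f -> supported (D :&: E) k f.
Proof. by move=> fD fE s fs; have [sD sk] := fD s fs; have [sE _] := fE s fs;
  rewrite inE sD. Qed.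

Definition down_closed (D : {set {set T}}) : Prop :=
  forall s t, s \in D -> t \subset s -> t \in D.

Lemma boundary_neq0 f t : boundary K T f t != 0 ->
  exists2 x, x \notin t & f (x |: t) != 0.
Proof.
rewrite boundaryE => nz.
have [/existsP[x /andP[xt fx]]|] :=
  boolP [exists x, (x \notin t) && (f (x |: t) != 0)]; first by exists x.
rewrite negb_exists => /forallP h; move: nz; rewrite big1 ?eqxx // => x xt.
by have := h x; rewrite xt /= negbK => /eqP->; rewrite mulr0.
Qed.

Lemma supported_boundary D k f :
  down_closed D -> supported D k.+1 f -> supported D k (boundary K T f).
Proof.
move=> cD fD t /boundary_neq0[x xt /fD[sD]].
rewrite cardsU1 xt => -[sk]; split=> //; exact: cD sD (subsetUr _ _).
Qed.

Lemma boundary_supported0 D f : supported D 0 f -> boundary K T f = 0.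
Proof.
move=> fD; apply/ffunP=> t; rewrite [RHS]ffunE.
apply/eqP/negP=> /negP /boundary_neq0[x xt /fD[_]].
by rewrite cardsU1 xt.
Qed.

(** Vanishing of the reduced homology in degree [k - 1], in terms of chains instead of quotients. *)
Definition exact_at (D : {set {set T}}) (k : nat) : Prop :=
  forall z, supported D k z -> boundary K T z = 0 ->
  exists2 y, supported D k.+1 y & boundary K T y = z.

Lemma supported_split (D E : {set {set T}}) k f : supported (D :|: E) k f ->
  exists g h, [/\ f = g + h, supported D k g & supported E k h].
Proof.
move=> fDE; exists [ffun s : {set T} => if s \in D then f s else 0].
exists [ffun s : {set T} => if s \in D then 0 else f s]; split.
- by apply/ffunP => s; rewrite !ffunE; case: ifP; rewrite ?addr0 ?add0r.
- move=> s; rewrite ffunE; case: ifP; rewrite ?eqxx // => sD /fDE[_ ->].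
  by split.
move=> s; rewrite ffunE; case: ifP; rewrite ?eqxx // => sD /fDE[].
by rewrite inE sD.
Qed.

(** In degree -1 every chain is a cycle, so the two summands are filled separately. *)
Lemma exact_union0 D E : exact_at D 0 -> exact_at E 0 -> exact_at (D :|: E) 0.
Proof.
move=> eD eE z /supported_split[g [h [-> gD hE]]] _.
have [y yD <-] := eD g gD (boundary_supported0 gD).
have [w wE <-] := eE h hE (boundary_supported0 hE).
exists (y + w); rewrite ?linearD //; apply: supportedD.
  exact: supported_sub (subsetUl _ _) yD.
exact: supported_sub (subsetUr _ _) wE.
Qed.

(** The boundary of [g] represents the connecting image of [z]; filling it by [y] in the
    intersection makes [g - y] and [h + y] cycles of [D] and [E]. *)
Lemma exact_unionS D E k : down_closed D -> down_closed E ->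
  exact_at D k.+1 -> exact_at E k.+1 -> exact_at (D :&: E) k ->
  exact_at (D :|: E) k.+1.
Proof.
move=> cD cE eD eE eI z /supported_split[g [h [-> gD hE]]] dz.
have dgh : boundary K T g = - boundary K T h.
  by move: dz; rewrite linearD => /eqP; rewrite addr_eq0 => /eqP.
have [||y yI dy] := eI (boundary K T g).
- apply: supportedI; first exact: supported_boundary.
  by rewrite dgh; apply/supportedN/supported_boundary.
- exact: boundary_boundary.
have [||u uD du] := eD (g - y).
- by apply: supportedB => //; exact: supported_sub (subsetIl _ _) yI.
- by rewrite linearB /= dy subrr.
have [||w wE dw] := eE (h + y).
- by apply: supportedD => //; exact: supported_sub (subsetIr _ _) yI.
- by rewrite linearD /= dy dgh subrr.
exists (u + w); last by rewrite linearD /= du dw addrACA addNr addr0.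
apply: supportedD; first exact: supported_sub (subsetUl _ _) uD.
exact: supported_sub (subsetUr _ _) wE.
Qed.

(** Another stretch of the Mayer-Vietoris sequence: the difference of two fillings of [z] is a cycle
    of the union, and splitting its filling [w] corrects both to one chain lying in [D] and in
    [E]. *)
Lemma exact_inter D E k : down_closed D -> down_closed E ->
  exact_at D k -> exact_at E k -> exact_at (D :|: E) k.+1 ->
  exact_at (D :&: E) k.
Proof.
move=> cD cE eD eE eU z zI dz.
have [|x xD dx] := eD z _ dz; first exact: supported_sub (subsetIl _ _) zI.
have [|y yE dy] := eE z _ dz; first exact: supported_sub (subsetIr _ _) zI.
have [||w wU dw] := eU (x - y).
- apply: supportedB; first exact: supported_sub (subsetUl _ _) xD.
  exact: supported_sub (subsetUr _ _) yE.
- by rewrite linearB /= dx dy subrr.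
have [g [h [ew gD hE]]] := supported_split wU.
exists (x - boundary K T g); last by rewrite linearB /= boundary_boundary subr0.
apply: supportedI; first by apply: supportedB => //; exact: supported_boundary.
have -> : x - boundary K T g = y + boundary K T h.
  by rewrite -(subrK y x) -dw ew linearD /= addrAC addrC; congr (_ + _);
    rewrite addrAC subrr add0r.
by apply: supportedD => //; exact: supported_boundary.
Qed.

(** By [boundary_cone], the cone with apex [v] over a cycle fills it, in degree -1 too. *)
Lemma exact_simplex (F : {set T}) v k : v \in F -> exact_at (powerset F) k.
Proof.
move=> vF z zF dz; exists (cone v z).
  move=> s; rewrite ffunE; case: ifP => vs; rewrite ?eqxx //.
  rewrite mulf_eq0 negb_or => /andP[_ /zF[]]; rewrite !inE => sF sk.
  by rewrite -(setD1K vs) subUset sub1set vF sF cardsU1 !inE eqxx sk.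
by rewrite -[RHS](boundary_cone v z) dz cone0 addr0.
Qed.

End Chains.

(** * Unions of simplices and the skeleta of their nerves *)

Section SimplexUnions.
Local Open Scope ring_scope.
Variables (K : fieldType) (T I : finType).
Implicit Types (B J : {set I}) (G : I -> {set T}).

Definition simplices B G : {set {set T}} :=
  [set s : {set T} | [exists i in B, s \subset G i]].

(** For nonempty [J], this says that [J] is a face of the nerve; for empty [J], only that [T] is
    inhabited. *)
Definition meets G J : Prop := exists v, forall i, i \in J -> v \in G i.

Lemma simplicesP B G (s : {set T}) :
  reflect (exists2 i, i \in B & s \subset G i) (s \in simplices B G).
Proof. by rewrite inE; apply: exists_inP. Qed.

Lemma simplices_closed B G : down_closed (simplices B G).
Proof.
move=> s t /simplicesP[i iB sG] ts; apply/simplicesP; exists i => //.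
exact: subset_trans ts sG.
Qed.

Lemma powerset_closed (F : {set T}) : down_closed (powerset F).
Proof. by move=> s t; rewrite !inE => sF ts; exact: subset_trans ts sF. Qed.

Lemma simplices_setU1 B G j :
  simplices (j |: B) G = powerset (G j) :|: simplices B G.
Proof.
apply/setP => s; rewrite in_setU powersetE; apply/simplicesP/orP.
  case=> i /setU1P[->|iB] sG; first by left.
  by right; apply/simplicesP; exists i.
case=> [sG|/simplicesP[i iB sG]]; first by exists j; rewrite ?setU11.
by exists i; rewrite ?setU1r.
Qed.

(** Keeps the Mayer-Vietoris inductions within unions of simplices over the same index set. *)
Lemma powersetI_simplices B G j :
  powerset (G j) :&: simplices B G = simplices B (fun i => G j :&: G i).
Proof.
apply/setP => s; rewrite in_setI powersetE.
apply/andP/simplicesP => [[sj /simplicesP[i iB si]]|[i iB]].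
  by exists i; rewrite // subsetI sj.
by rewrite subsetI => /andP[sj si]; split=> //; apply/simplicesP; exists i.
Qed.

Lemma meets_setU1 G j J :
  meets G (j |: J) -> meets (fun i => G j :&: G i) J.
Proof.
by case=> v vG; exists v => i iJ; rewrite inE !vG ?setU11 ?setU1r.
Qed.

Lemma meets_setI G j J : J != set0 ->
  meets (fun i => G j :&: G i) J -> meets G (j |: J).
Proof.
move=> /set0Pn[i0 i0J] [v vG]; exists v => i /setU1P[->|/vG].
  by have /setIP[] := vG _ i0J.
by case/setIP.
Qed.

Lemma exact_at_unsupported (D : {set {set T}}) k :
  (forall s, s \in D -> #|s| != k) -> exact_at K D k.
Proof.
move=> Dk z zD _; have -> : z = 0.
  apply/ffunP => s; rewrite [RHS]ffunE; apply/eqP/negP => /negP /zD[sD sk].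
  by have := Dk s sD; rewrite sk eqxx.
by exists 0; rewrite ?linear0 // => s; rewrite ffunE eqxx.
Qed.

(** The shift to [k.+1] allows an empty [F], whose powerset has homology only in degree -1. *)
Lemma exact_powersetS (F : {set T}) k : exact_at K (powerset F) k.+1.
Proof.
have [->|[v vF]] := set_0Vmem F; last exact: exact_simplex vF.
apply: exact_at_unsupported => s; rewrite powersetE subset0 => /eqP->.
by rewrite cards0.
Qed.

(** Induction on the number of simplices, splitting off [G j]: the traces of the others on [G j]
    meet up to one member fewer, which suffices for the intersection term one degree lower. *)
Lemma exact_of_meets k B G :
    (forall J, J \subset B -> J != set0 -> (#|J| <= k.+1)%N -> meets G J) ->
  exact_at K (simplices B G) k.
Proof.
have [n] := ubnP #|B|; elim: n B k G => // n IHn B k G.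
have [->|[j jB]] := set_0Vmem B => Bn HJ.
  (* With [B] empty there is not even the empty face, so every degree is exact. *)
  by apply: exact_at_unsupported => s /simplicesP[i]; rewrite inE.
rewrite (cardsD1 j) jB ltnS in Bn; rewrite -(setD1K jB) simplices_setU1.
have sBB : B :\ j \subset B by rewrite subsetDl.
have [v vj] : meets G [set j].
  by apply: HJ; rewrite ?sub1set ?cards1 // -card_gt0 cards1.
have eB : exact_at K (simplices (B :\ j) G) k.
  by apply: IHn => // J JB; apply: HJ; apply: subset_trans JB sBB.
have eP l : exact_at K (powerset (G j)) l.
  by apply: (@exact_simplex _ _ _ v); apply: vj; rewrite inE.
case: k HJ eB => [|k] HJ eB; first exact: exact_union0.
apply: exact_unionS => //; [exact: powerset_closed|exact: simplices_closed|].
rewrite powersetI_simplices; apply: IHn => // J JB J0 Jk.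
apply: meets_setU1; apply: HJ.
- by rewrite subUset sub1set jB; apply: subset_trans JB sBB.
- by apply/set0Pn; exists j; rewrite setU11.
- by rewrite cardsU1; case: (j \notin J); rewrite //= ltnW.
Qed.

(** Here the nerve has dimension below [k]. The same induction works, since a subfamily of traces on
    [G j] that meets gains the member [j]. *)
Lemma exact_of_not_meets k B G :
    (forall J, J \subset B -> #|J| = k.+1 -> ~ meets G J) ->
  exact_at K (simplices B G) k.+1.
Proof.
have [n] := ubnP #|B|; elim: n B k G => // n IHn B k G.
have [->|[j jB]] := set_0Vmem B => Bn HJ.
  by apply: exact_at_unsupported => s /simplicesP[i]; rewrite inE.
case: k HJ => [|k] HJ.
  (* For [k = 0] no simplex has a vertex, so no face has exactly one element. *)
  apply: exact_at_unsupported => s /simplicesP[i iB sG].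
  apply/negP => /cards1P[v sv]; apply: (HJ [set i]).
  - by rewrite sub1set.
  - by rewrite cards1.
  by exists v => i'; rewrite inE => /eqP->; rewrite -sub1set -sv.
rewrite (cardsD1 j) jB ltnS in Bn; rewrite -(setD1K jB) simplices_setU1.
have sBB : B :\ j \subset B by rewrite subsetDl.
apply: exact_unionS; [exact: powerset_closed|exact: simplices_closed| | |].
- exact: exact_powersetS.
- by apply: IHn => // J JB; apply: HJ; apply: subset_trans JB sBB.
rewrite powersetI_simplices; apply: IHn => // J JB Jk mJ; apply: (HJ (j |: J)).
- by rewrite subUset sub1set jB; apply: subset_trans JB sBB.
- have jJ : j \notin J by apply/negP => /(subsetP JB); rewrite !inE eqxx.
  by rewrite cardsU1 jJ Jk.
- by apply: meets_setI => //; rewrite -card_gt0 Jk.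
Qed.

(* G j and the union of the other simplices are exact in degree k - 1, so
   exactness of the whole at k would pass to their intersection at k - 1, which
   is again a union of simplices of the same kind. *)
Lemma not_exact_skeleton k B G : (k < #|B|)%N ->
    (forall J, J \subset B -> J != set0 -> (#|J| <= k)%N -> meets G J) ->
    (forall J, J \subset B -> #|J| = k.+1 -> ~ meets G J) ->
  ~ exact_at K (simplices B G) k.
Proof.
elim: k B G => [|k IHk] B G kB HJ NJ ex.
  have /card_gt0P[j jB] := kB.
  (* The only face is the empty one. Its basis chain is a cycle, and a filling would be supported on
     single vertices, hence zero. *)
  have [||y yD dy] := ex (basis_chain K set0).
  - move=> s; rewrite ffunE; have [->|] := eqVneq s set0; rewrite ?eqxx //.
    by move=> _; rewrite cards0; split=> //; apply/simplicesP; exists j;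
      rewrite ?sub0set.
  - apply/ffunP => t; rewrite boundaryE ffunE big1 // => x xt; rewrite ffunE.
    rewrite (_ : (_ == _) = false) ?mulr0 //.
    by apply/negP => /eqP/setP/(_ x); rewrite !inE eqxx.
  have y0 : y = 0.
    apply/ffunP => s; rewrite [RHS]ffunE; apply/eqP/negP => /negP /yD[].
    move=> /simplicesP[i iB sG] /eqP/cards1P[v sv]; apply: (NJ [set i]).
    - by rewrite sub1set.
    - by rewrite cards1.
    by exists v => i'; rewrite inE => /eqP->; rewrite -sub1set -sv.
  move/ffunP/(_ set0): dy; rewrite y0 linear0 !ffunE eqxx => /esym/eqP.
  by rewrite oner_eq0.
have /card_gt0P[j jB] : (0 < #|B|)%N by apply: leq_trans kB.
have sBB : B :\ j \subset B by rewrite subsetDl.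
have [v vj] : meets G [set j].
  by apply: HJ; rewrite ?sub1set ?cards1 // -card_gt0 cards1.
rewrite (cardsD1 j) jB ltnS in kB.
apply: (IHk (B :\ j) (fun i => G j :&: G i) kB).
- move=> J JB J0 Jk; apply: meets_setU1; apply: HJ.
  + by rewrite subUset sub1set jB; apply: subset_trans JB sBB.
  + by apply/set0Pn; exists j; rewrite setU11.
  + by rewrite cardsU1; case: (j \notin J); rewrite //= ltnW.
- move=> J JB Jk mJ; apply: (NJ (j |: J)).
  + by rewrite subUset sub1set jB; apply: subset_trans JB sBB.
  + have jJ : j \notin J by apply/negP => /(subsetP JB); rewrite !inE eqxx.
    by rewrite cardsU1 jJ Jk.
  + by apply: meets_setI => //; rewrite -card_gt0 Jk.
rewrite -powersetI_simplices; apply: exact_inter.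
- exact: powerset_closed.
- exact: simplices_closed.
- by apply: (@exact_simplex _ _ _ v); apply: vj; rewrite inE.
- apply: exact_of_meets => J JB; apply: HJ; exact: subset_trans JB sBB.
- by rewrite -simplices_setU1 setD1K.
Qed.

End SimplexUnions.

(** * From exactness to the homology spaces *)

Section Homology.
Local Open Scope ring_scope.
Variables (K : fieldType) (T : finType).

Lemma chainsP (D : complex T) k (f : chain_space K T) :
  reflect (supported (faces D) k f) (f \in chains K D k).
Proof.
apply: (iffP idP) => [fD s fs|fD]; last first.
  rewrite (chainE f); apply: memv_suml => s _.
  have [->|/fD[sD sk]] := eqVneq (f s) 0; first by rewrite scale0r mem0v.
  apply/memvZ/memv_span/map_f; rewrite mem_enum inE sD; exact/eqP.
suff : (s \in faces D) && (#|s| == k) by case/andP => ? /eqP.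
apply: contraNT fs => sDk; apply/eqP.
have /(@coord_span _ _ _ (in_tuple _))-> := fD.
rewrite sum_ffunE big1 // => i _; rewrite ffunE.
have /mapP[t] := mem_nth 0 (ltn_ord i).
rewrite mem_enum inE => tDk ->; rewrite ffunE.
have [st|] := eqVneq s t; last by rewrite scaler0.
by rewrite -st (negPf sDk) in tDk.
Qed.

Lemma homology_neq0 (D : complex T) k :
  homology K D k != 0%VS <-> ~ exact_at K (faces D) k.
Proof.
suff : homology K D k == 0%VS <-> exact_at K (faces D) k.
  by case=> h1 h2; split=> [/negP nh /h2|nex]; [|apply/negP => /h1].
rewrite diffv_eq0; split=> [/subvP sub z zD dz|ex].
  have /sub/memv_imgP[y /chainsP yD ->] : z \in cycles K D k.
    by rewrite memv_cap memv_ker dz eqxx andbT; apply/chainsP.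
  by exists y.
apply/subvP => z; rewrite memv_cap memv_ker => /andP[/chainsP zD /eqP dz].
have [y yD <-] := ex z zD dz.
by apply: memv_img; apply/chainsP.
Qed.

End Homology.

Lemma exists_subset_card (T : finType) (A B : {set T}) k :
  A \subset B -> #|A| <= k <= #|B| ->
  exists S : {set T}, [/\ A \subset S, S \subset B & #|S| = k].
Proof.
move=> AB /andP[Ak kB].
have : 0 < #|[set U : {set T} | U \subset B :\: A & #|U| == k - #|A|]|.
  by rewrite cards_draws bin_gt0 cardsD (setIidPr AB) leq_sub2r.
case/card_gt0P => U; rewrite inE => /andP[UBA /eqP Uk].
exists (A :|: U); rewrite subsetUl subUset AB; split=> //.
  by apply: subset_trans UBA (subsetDl _ _).
rewrite cardsU Uk (_ : A :&: U = set0) ?cards0 ?subn0 ?subnKC //.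
apply/eqP; rewrite setI_eq0 disjoint_sym disjoints_subset.
by apply: subset_trans UBA _; rewrite setDE subsetIr.
Qed.

(** * Links of faces of an intersection complex *)

Section IntersectionLinks.
Variables (K : fieldType) (n : nat) (m : n.-tuple nat) (p : nat).
Hypotheses (p_gt0 : 0 < p) (p_lt : p < n) (mp : entry m p != 0).
Hypothesis (p_max : forall j, entry m j != 0 -> j <= p).
Implicit Types (s t : {set ivertex m}) (v : ivertex m) (A J S : {set 'I_n}).

Let Delta := intersection_complex m.

(** The common part of the facets indexed by [A]. With [common_facets] it forms a Galois connection,
    and faces whose link has homology are closed for it. *)
Definition star_of A : {set ivertex m} :=
  [set v : ivertex m | A \subset support_of v].

Definition common_facets s : {set 'I_n} := [set j | s \subset facet m j].

Lemma entry_support v : entry m #|support_of v| != 0.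
Proof.
by case: v => S i; rewrite -lt0n; exact: leq_ltn_trans (leq0n i) (ltn_ord i).
Qed.

Lemma exists_vertex S : S != set0 -> entry m #|S| != 0 ->
  exists v : ivertex m, support_of v = S.
Proof.
rewrite -lt0n => S0 mS.
pose S' : nonempty_subset n := exist _ S S0.
pose copies (U : nonempty_subset n) := 'I_(entry m #|val U|).
by exists (existT copies S' (Ordinal mS)).
Qed.

(** A support of size exactly [p] is chosen: vertices of that size exist by [mp], and [p < n] leaves
    room to omit [a]. *)
Lemma exists_vertex_avoiding A a : #|A| <= p -> a \notin A ->
  exists2 v : ivertex m, A \subset support_of v & a \notin support_of v.
Proof.
move=> Ap aA; have [||S [AS Sa Sp]] := @exists_subset_card _ A [set~ a] p.
- by apply/subsetP => x xA; rewrite !inE; apply: contraNneq aA => <-.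
- by rewrite Ap cardsC1 card_ord; lia.
have [||v vS] := @exists_vertex S; rewrite ?Sp -?card_gt0 ?Sp //.
by exists v; rewrite vS //; apply/negP => /(subsetP Sa); rewrite !inE eqxx.
Qed.

Lemma faces_link s : faces (link Delta s) =
  simplices (common_facets s) (fun j => facet m j :\: s).
Proof.
apply/setP => t; apply/idP/simplicesP => [|[j]].
  rewrite inE => /and3P[_ st]; rewrite inE => /existsP[j].
  rewrite subUset => /andP[sj tj]; exists j; rewrite ?inE // subsetD tj /=.
  by rewrite disjoint_sym -setI_eq0.
rewrite inE => sj; rewrite subsetD => /andP[tj ts]; rewrite !inE.
rewrite setI_eq0 disjoint_sym ts /=.
by apply/andP; split; apply/existsP; exists j; rewrite // subUset sj.
Qed.

Lemma meets_link s J : J != set0 ->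
  meets (fun j => facet m j :\: s) J <->
  exists2 v, v \notin s & J \subset support_of v.
Proof.
move=> /set0Pn[j0 j0J]; split=> [[v vJ]|[v vs Jv]].
  exists v; first by have /setDP[] := vJ _ j0J.
  by apply/subsetP => j /vJ; rewrite !inE => /andP[].
by exists v => j jJ; rewrite !inE vs (subsetP Jv).
Qed.

Lemma sub_star_common s : s \subset star_of (common_facets s).
Proof.
apply/subsetP => v vs; rewrite inE; apply/subsetP => j; rewrite inE.
by move=> /subsetP/(_ v vs); rewrite inE.
Qed.

Lemma homology_link s k : s \in faces Delta ->
  homology K (link Delta s) k != 0%VS <->
  s = star_of (common_facets s) /\ k = minn #|common_facets s|.-1 p.
Proof.
rewrite inE => /existsP[j0 sj0]; set A := common_facets s.
have j0A : j0 \in A by rewrite inE.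
have A_gt0 : 0 < #|A| by apply/card_gt0P; exists j0.
apply: iff_trans; first exact: homology_neq0.
rewrite faces_link -/A.
have [/subsetP stars|] := boolP (star_of A \subset s); last first.
  (* Such a [v] lies in every simplex of the link, so all degrees are exact. *)
  case/subsetPn => v vA vs; split=> [[]|[sA _]]; last by rewrite sA vA in vs.
  apply: exact_of_meets => J JA J0 _; apply/meets_link => //; exists v => //.
  by apply: subset_trans JA _; rewrite inE in vA.
have sA : s = star_of A.
  by apply/eqP; rewrite eqEsubset sub_star_common; apply/subsetP.
(* A set [J] smaller than [A] misses some [a] in [A]; a vertex over [J] avoiding [a] is outside
   [s]. *)
have meetJ J : J \subset A -> J != set0 -> #|J| <= minn #|A|.-1 p ->
    meets (fun j => facet m j :\: s) J.
  rewrite leq_min => JA J0 /andP[JA1 Jp]; apply/meets_link => //.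
  have /properP[_ [a aA aJ]] : J \proper A by rewrite properEcard JA; lia.
  have [v Jv av] := exists_vertex_avoiding Jp aJ; exists v => //.
  by rewrite sA inE; apply: contra av => /subsetP/(_ a aA).
(* Either [J] is all of [A], and every vertex over it is in [s], or [J] has more than [p] elements,
   too many for a support. *)
have nmeetJ J : J \subset A -> minn #|A|.-1 p < #|J| ->
    ~ meets (fun j => facet m j :\: s) J.
  move=> JA Jk; rewrite meets_link -?card_gt0; last by lia.
  case=> v vs Jv; move: Jk; rewrite gtn_min => /orP[JA1|pJ].
    case/negP: vs; apply: stars; rewrite inE (_ : A = J) //.
    by apply/esym/eqP; rewrite eqEcard JA; lia.
  have := p_max (entry_support v); have := subset_leq_card Jv; lia.
split=> [nex|[_ ->]]; last first.
  apply: not_exact_skeleton => //; first by lia.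
  by move=> J JA Jk; apply: nmeetJ; rewrite ?Jk.
split=> //; have [klt|kgt|//] := ltngtP k (minn #|A|.-1 p); case: nex.
  apply: exact_of_meets => J JA J0 Jk; apply: meetJ => //; exact: leq_trans Jk klt.
case: k kgt => // k kgt; apply: exact_of_not_meets => J JA Jk; apply: nmeetJ => //.
by rewrite Jk.
Qed.

(** For [k < n], the number of vertices whose support contains a fixed set of [k + 1] indices; [j]
    counts the further indices. It will serve as the size $s_k$. *)
Definition link_size (k : nat) : nat :=
  \sum_(0 <= j < (n - k.+1).+1) 'C(n - k.+1, j) * entry m (k.+1 + j).

(** Vertices are counted by support, each support is written as [A] plus a disjoint [U], and the
    sets [U] are grouped by size. *)
Lemma card_star A : A != set0 -> #|star_of A| = link_size #|A|.-1.
Proof.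
move=> A0; have A_gt0 : 0 < #|A| by rewrite card_gt0.
rewrite /link_size prednK // -sum1_card.
transitivity (\sum_(S : nonempty_subset n | A \subset val S)
                \sum_(i < entry m #|val S|) 1).
  by rewrite sig_big_dep /=; apply: eq_bigl => v; rewrite inE andbT.
transitivity (\sum_(S : {set 'I_n} | A \subset S) entry m #|S|).
  under eq_bigr do rewrite sum1_card card_ord.
  rewrite [RHS](reindex_omap (val : nonempty_subset n -> _) insub) /=.
    by apply: eq_bigl => S; rewrite valK eqxx andbT.
  move=> S AS; have S0 : S != set0.
    by apply: contraNneq A0 => S0; rewrite -subset0 -S0.
  by rewrite (insubT (fun S : {set 'I_n} => S != set0) S0).
rewrite (reindex_onto (fun U => A :|: U) (fun S => S :\: A)) /=; last first.
  by move=> S AS; rewrite -[RHS](setID S A) (setIidPr AS).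
transitivity (\sum_(U : {set 'I_n} | U \subset ~: A) entry m (#|A| + #|U|)).
  have UA U : ((A :|: U) :\: A == U) = (U \subset ~: A).
    by rewrite setDUl setDv set0U setDE; apply/eqP/setIidPl.
  under eq_bigl do rewrite subsetUl UA.
  apply: eq_bigr => U UnA.
  rewrite cardsU (_ : A :&: U = set0) ?cards0 ?subn0 //.
  by apply/eqP; rewrite setI_eq0 disjoint_sym disjoints_subset.
have nA : #|~: A| = n - #|A| by have := cardsC A; rewrite card_ord; lia.
(* The default value of [inord] is never reached: [U] lies in the complement of [A]. *)
pose size_ord (U : {set 'I_n}) : 'I_(n - #|A|).+1 := inord #|U|.
rewrite big_mkord (partition_big size_ord predT) //=.
apply: eq_bigr => j _; rewrite -[X in 'C(X, _)]nA -cards_draws -sum_nat_const.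
apply: eq_big => [U|U /andP[UA /eqP<-]]; rewrite ?inE /size_ord.
  case: (boolP (U \subset ~: A)) => //= /subset_leq_card; rewrite nA => Uj.
  by rewrite -val_eqE /= inordK.
by rewrite inordK // -nA ltnS subset_leq_card.
Qed.

(** Only entries beyond [p] occur. This matches the size of the empty face, the one carrying the top
    degree. *)
Lemma link_size_max : link_size p = 0.
Proof.
rewrite /link_size big1_seq // => j _; apply/eqP; rewrite muln_eq0 orbC.
by apply/orP; left; apply/negP => /negP /p_max; lia.
Qed.

Lemma card_face_homology s k : s \in faces Delta ->
  homology K (link Delta s) k != 0%VS -> k <= p /\ #|s| = link_size k.
Proof.
move=> sD /(homology_link k sD); set A := common_facets s => -[sA ->].
split; first by rewrite geq_minr.
move: sD; rewrite inE => /existsP[j0 sj0].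
have A0 : A != set0 by apply/set0Pn; exists j0; rewrite inE.
have [Ap|pA] := leqP #|A| p.
  rewrite sA card_star // (minn_idPl _) //.
  exact: leq_trans (leq_pred _) Ap.
(* More than [p] indices fit in no support, so [s] is empty. *)
rewrite (minn_idPr _) ?link_size_max; last by lia.
apply/eqP; rewrite cards_eq0 sA; apply/eqP/setP => v; rewrite !inE.
apply/negP => /subset_leq_card; have := p_max (entry_support v); lia.
Qed.

Lemma exists_face_homology k : k <= p ->
  exists2 s, s \in faces Delta & homology K (link Delta s) k != 0%VS.
Proof.
move=> kp.
(* For [k = p] take all indices; for [k < p] any [k + 1] of them, at most [p], so that avoiding
   vertices show [A] to be closed. *)
have [A [A0 Ak cA]] : exists A, [/\ A != set0, minn #|A|.-1 p = k
    & common_facets (star_of A) \subset A].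
  move: kp; rewrite leq_eqVlt => /predU1P[->|kp].
    exists setT; rewrite -card_gt0 cardsT card_ord subsetT; split=> //; lia.
  have [||A [_ _ Ak]] := @exists_subset_card _ set0 [set: 'I_n] k.+1.
  - exact: sub0set.
  - by rewrite cards0 cardsT card_ord; lia.
  exists A; rewrite -card_gt0 Ak; split=> //=; first by lia.
  apply/subsetP => a; apply: contraLR => aA.
  have [|v Av av] := @exists_vertex_avoiding A a _ aA; first by rewrite Ak.
  rewrite inE; apply/subsetPn; exists v; rewrite inE //.
have AsA : common_facets (star_of A) = A.
  apply/eqP; rewrite eqEsubset cA; apply/subsetP => a aA.
  by rewrite inE; apply/subsetP => v; rewrite !inE => /subsetP/(_ a aA).
have sD : star_of A \in faces Delta.
  have [a aA] := set0Pn _ A0; rewrite inE; apply/existsP; exists a.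
  by move: aA; rewrite -{1}AsA inE.
by exists (star_of A) => //; apply/homology_link; rewrite // AsA.
Qed.

(** Pascal's rule, with [n - i = l + 1]. The last term of each [link_size] sum has entry index [n]
    and vanishes by [mn]. *)
Lemma link_size_pred i : entry m n = 0 -> 0 < i <= p -> link_size i.-1 =
  link_size i +
  \sum_(0 <= j < (n - i - 1).+1) 'C(n - i - 1, j) * entry m (i + j).
Proof.
move=> mn /andP[i0 ip]; rewrite /link_size prednK // subnS -subn1.
set l := n - i - 1; have -> : n - i = l.+1 by lia.
rewrite big_nat_recr //= binn mul1n (_ : i + l.+1 = n) ?mn ?addn0; last by lia.
rewrite big_nat_recl // bin0 mul1n addn0.
rewrite [X in _ = X + _]big_nat_recr //= (_ : i.+1 + l = n); last by lia.
rewrite mn muln0 addn0.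
rewrite [X in _ = _ + X]big_nat_recl // bin0 mul1n addn0 addnCA -big_split /=.
congr (_ + _); apply: eq_bigr => j _.
by rewrite binS mulnDl addnC addSnnS.
Qed.

End IntersectionLinks.

(** * The PR property and the degree type *)

Theorem theorem5p29 (K : fieldType) (n : nat) (m : n.-tuple nat) (p : nat)
    (m_neq0 : exists j : nat, (1 <= j <= n)%N /\ entry m j <> 0%N)
    (m_n : entry m n = 0%N)
    (def_p : p = (\max_(1 <= j < n.+1 | entry m j != 0%N) j)%N) :
  is_PR K (intersection_complex m) /\
  has_degree_type K (intersection_complex m)
    [seq (\sum_(0 <= j < (n - i - 1).+1) 'C(n - i - 1, j) * entry m (i + j))%N
       | i <- rev (iota 1 p)].
Proof.
have p_max j : entry m j != 0 -> j <= p.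
  move=> mj; have jn : 0 < j <= n.
    case: j mj => [|j] //; rewrite /entry /=; case: ltnP => // nj.
    by rewrite nth_default ?size_tuple.
  by rewrite def_p; apply: leq_bigmax_seq => //; rewrite mem_index_iota.
have [mp p_gt0] : entry m p != 0 /\ 0 < p.
  have [j [/andP[j_gt0 jn] /eqP mj]] := m_neq0.
  split; last exact: leq_trans (p_max j mj).
  (* Positivity is kept as a premise of the induction on the maximum, to discard its default value
     0. *)
  have : 0 < p by exact: leq_trans (p_max j mj).
  rewrite def_p; elim/big_ind: _ => // x y hx hy.
  by rewrite /maxn; case: ifP.
have p_lt : p < n.
  rewrite ltn_neqAle; apply/andP; split.
    by apply: contraNneq mp => ->; rewrite m_n.
  rewrite leqNgt; apply/negP => np; case/negP: mp.
  by case: (p) np => // q nq; rewrite /entry /= nth_default ?size_tuple.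
have size_s := card_face_homology p_gt0 p_lt mp p_max.
have ex_s := exists_face_homology K p_gt0 p_lt mp p_max.
split=> [k s t sD tD /(size_s _ _ _ sD)[_ ->] /(size_s _ _ _ tD)[_ ->] //|].
exists p, (link_size m); split.
- exact: ex_s.
- by move=> k s sD /(size_s _ _ _ sD)[].
- move=> i ip; split; first exact: ex_s.
  by move=> s sD /(size_s _ _ _ sD)[].
rewrite -map_comp; apply/eq_in_map => i.
rewrite mem_rev mem_iota => /andP[i1 ip] /=.
rewrite (link_size_pred p_gt0 p_lt) //; last by lia.
by rewrite PoszD addrC addKr.
Qed.
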